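(* Let $\mathcal{C}\subseteq\mathbb{R}^n$ be nonempty, compact and convex, let $F:\mathcal{C}\to\mathbb{R}^n$ be monotone and $C^1$, and let $\{x_k\}_{k\ge 0}$ be a sequence generated by the Frank-Wolfe iteration $$x_{k+1}=x_k+\gamma_{k+1}(s_k-x_k),\qquad s_k\in\operatorname{argmin}_{s\in\mathcal{C}}\langle F(x_k),s\rangle,\qquad x_0\in\mathcal{C},$$ with step sizes $\gamma_k\in(0,1]$ $(k\ge 1)$ satisfying $\gamma_k\to 0$ and $\sum_{k=1}^\infty\gamma_k=\infty$. Let $V(x)=\max_{s\in\mathcal{C}}\langle F(x),x-s\rangle$ for $x\in\mathcal{C}$. Then $V(x_k)\to 0$ as $k\to\infty$.
   Context: $\langle\cdot,\cdot\rangle$ is the Euclidean inner product on $\mathbb{R}^n$. $F$ is monotone if $\langle F(x)-F(y),x-y\rangle\ge 0$ for all $x,y\in\mathcal{C}$. At each step $s_k$ is an arbitrary element of the (possibly non-singleton) argmin set. $V$ is called the Frank-Wolfe gap. *)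

(* Defs.v *)
From HB Require Import structures.
From mathcomp Require Import all_boot all_order all_algebra.
From mathcomp Require Import all_classical all_reals all_analysis.
Set Implicit Arguments.
Unset Strict Implicit.
Unset Printing Implicit Defensive.
Import Order.TTheory GRing.Theory Num.Theory numFieldNormedType.Exports.
Local Open Scope classical_set_scope.
Local Open Scope ring_scope.

(* R^n is 'rV[R]_n. The library norm on it is the sup norm; it induces the
   Euclidean topology and the same differentiability notion. *)
Definition inner (R : realType) (n : nat) (u v : 'rV[R]_n) : R :=
  \sum_(i < n) u ord0 i * v ord0 i.

Definition monotone_on (R : realType) (n : nat) (C : set 'rV[R]_n)
    (F : 'rV[R]_n -> 'rV[R]_n) : Prop :=
  forall x y, C x -> C y -> 0 <= inner (F x - F y) (x - y).

(* C^1 regularity of a map defined only on C: a derivative relative to C that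
   is continuous on C. C need not be open (nor have interior points), so the
   derivative need not be unique and its choice is quantified existentially.
   Matrices act on row vectors from the right. Only the values of F on C
   matter. *)
Definition C1_on (R : realType) (n : nat) (C : set 'rV[R]_n)
    (F : 'rV[R]_n -> 'rV[R]_n) : Prop :=
  exists dF : 'rV[R]_n -> 'M[R]_n,
    {within C, continuous dF} /\
    forall x, C x -> forall e : R, 0 < e ->
      \forall y \near within C (nbhs x),
        `|F y - F x - (y - x) *m dF x| <= e * `|y - x|.

Definition argmin_on (R : realType) (T : Type) (C : set T) (f : T -> R)
    : set T :=
  [set s | C s /\ forall t, C t -> f s <= f t].

(* Written as a supremum; fw_gap_max shows that it is a maximum when C is
   nonempty and compact. *)
Definition fw_gap (R : realType) (n : nat) (C : set 'rV[R]_n)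
    (F : 'rV[R]_n -> 'rV[R]_n) (x : 'rV[R]_n) : R :=
  sup [set inner (F x) (x - s) | s in C].

Definition frank_wolfe (R : realType) (n : nat) (C : set 'rV[R]_n)
    (F : 'rV[R]_n -> 'rV[R]_n) (gamma : nat -> R) (x s : nat -> 'rV[R]_n)
    : Prop :=
  C (x 0) /\
  forall k, argmin_on C (inner (F (x k))) (s k) /\
            x k.+1 = x k + gamma k.+1 *: (s k - x k).

Lemma inner_continuous (R : realType) (n : nat) (u : 'rV[R]_n) :
  continuous (inner u).
Proof.
apply: continuous_big => [|i _].
  exact: add_continuous.
move=> v; apply: (@cvgM _ _ (nbhs v)); first exact: cvg_cst.
exact: coord_continuous.
Qed.

Lemma fw_gap_max (R : realType) (n : nat) (C : set 'rV[R]_n)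
    (F : 'rV[R]_n -> 'rV[R]_n) (x : 'rV[R]_n) :
  C !=set0 -> compact C ->
  (exists2 s, C s & fw_gap C F x = inner (F x) (x - s)) /\
  (forall s, C s -> inner (F x) (x - s) <= fw_gap C F x).
Proof.
move=> C0 cC; set A := [set inner (F x) (x - s) | s in C].
have cA : compact A.
  have cf : continuous (fun s : 'rV[R]_n => inner (F x) (x - s)).
    move=> s; apply: (@cvg_comp _ _ _ (fun s : 'rV[R]_n => x - s)
      (inner (F x)) _
      (nbhs (x - s))); last exact: inner_continuous.
    by apply: (@cvgB _ _ _ (nbhs s)); [exact: cvg_cst | exact: cvg_id].
  by apply: continuous_compact cC; exact: continuous_subspaceT.
have A0 : A !=set0 by case: C0 => s Cs; exists (inner (F x) (x - s)), s.
have supA : has_sup A by exact: compact_has_sup.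
split; last first.
  by move=> s Cs; apply: sup_upper_bound => //; exists s.
have [s Cs supE] : A (sup A).
  have clA : closed A by apply: compact_closed cA; exact: Rhausdorff.
  by apply: clA; apply: closure_sup => //; case: supA.
by exists s; rewrite // supE.
Qed.

Lemma C1_on_differentiable (R : realType) (n : nat) (C : set 'rV[R]_n)
    (F : 'rV[R]_n -> 'rV[R]_n) :
  (forall x, C x -> differentiable F x) ->
  {within C, continuous (jacobian F)} -> C1_on C F.
Proof.
move=> dF cJ; exists (jacobian F); split=> //.
move=> x /dF Fx e e0; have /diff_locallyP[_ /eqaddoP dFx] := Fx.
have {}dFx := dFx e e0.
suff : \forall y \near x,
    `|F y - F x - (y - x) *m jacobian F x| <= e * `|y - x|.
  exact: cvg_within.
rewrite (near_shift 0) subr0; apply: filterS dFx => h /=.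
by rewrite /jacobian addrK !fctE opprD addrA -deriveEjacobian// deriveE.
Qed.

(* Main.v *)
Require Import Defs.
From HB Require Import structures.
From mathcomp Require Import all_boot all_order all_algebra.
From mathcomp Require Import all_classical all_reals all_analysis.
From mathcomp Require Import ring lra.
Import Order.TTheory GRing.Theory Num.Theory numFieldNormedType.Exports.
Local Open Scope classical_set_scope.
Local Open Scope ring_scope.

(** In continuous time, x' = s - x with s minimizing <F x, .> over C, and the
    gap V satisfies V' = - <(s - x) dF, s - x> - V <= - V, because monotonicity
    makes dF positive semidefinite along C. In discrete time consecutive
    minimizers s_k, s_{k+1} can be far apart, and V need not decrease at each
    step; the continuous picture only governs averages of the s_k over blocks
    of steps.

    The argument uses it at one point only. Let v be the limit superior of
    V(x_k), and let p be a cluster point of a subsequence along which V(x_k)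
    tends to v; then V(p) >= v because V is upper semicontinuous. Look back
    from indices k with x_k close to p, over a block of steps of total length T
    (frank_wolfe_backward). Since the step sizes tend to 0 and have infinite
    sum, such blocks exist with T arbitrarily small and arbitrarily late. The
    starting point q of the block satisfies p - q = T (m - p) + o(T), where m,
    the weighted mean of the s_i in the block, nearly minimizes <F p, .>;
    moreover V(q) <= v + o(T) <= V(p) + o(T), as q occurs late in the sequence.
    When T tends to 0 along a suitable sequence, m tends to an exact minimizer
    s of <F p, .> (backward_argmin), and the differential inequality above,
    taken backwards at p, gives V(p) - V(q) <= - T V(p) + o(T)
    (backward_gap_le0). Together, V(p) <= 0. Hence v <= 0, and V >= 0 gives the
    convergence.

    The backward direction matters: the averaged velocities of blocks ending
    near p cluster at s - p for some minimizer s at p, and this same s can be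
    used as the competitor that bounds V(q) from below. *)

Set Implicit Arguments.
Unset Strict Implicit.
Unset Printing Implicit Defensive.

(** * The inner product and the sup norm *)

Lemma innerDl (R : realType) (n : nat) (u v w : 'rV[R]_n) :
  inner (u + v) w = inner u w + inner v w.
Proof.
by rewrite /inner -big_split; apply: eq_bigr => i _; rewrite mxE mulrDl.
Qed.

Lemma innerZl (R : realType) (n : nat) (a : R) (u w : 'rV[R]_n) :
  inner (a *: u) w = a * inner u w.
Proof.
by rewrite /inner mulr_sumr; apply: eq_bigr => i _; rewrite mxE mulrA.
Qed.

Lemma innerC (R : realType) (n : nat) (u v : 'rV[R]_n) : inner u v = inner v u.
Proof. by apply: eq_bigr => i _; rewrite mulrC. Qed.

Lemma innerNl (R : realType) (n : nat) (u w : 'rV[R]_n) :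
  inner (- u) w = - inner u w.
Proof. by rewrite -scaleN1r innerZl mulN1r. Qed.

Lemma innerNr (R : realType) (n : nat) (u w : 'rV[R]_n) :
  inner w (- u) = - inner w u.
Proof. by rewrite innerC innerNl innerC. Qed.

Lemma innerBl (R : realType) (n : nat) (u v w : 'rV[R]_n) :
  inner (u - v) w = inner u w - inner v w.
Proof. by rewrite innerDl innerNl. Qed.

Lemma innerDr (R : realType) (n : nat) (u v w : 'rV[R]_n) :
  inner w (u + v) = inner w u + inner w v.
Proof. by rewrite innerC innerDl !(innerC w). Qed.

Lemma innerBr (R : realType) (n : nat) (u v w : 'rV[R]_n) :
  inner w (u - v) = inner w u - inner w v.
Proof. by rewrite innerC innerBl !(innerC w). Qed.

Lemma innerZr (R : realType) (n : nat) (a : R) (u w : 'rV[R]_n) :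
  inner w (a *: u) = a * inner w u.
Proof. by rewrite innerC innerZl innerC. Qed.

Lemma le_norm_coord (R : realType) (m n : nat) (A : 'M[R]_(m, n)) i j :
  `|A i j| <= `|A|.
Proof.
have -> : `|A| = mx_norm A by [].
rewrite mx_normrE.
exact: (le_bigmax _ (fun ij : 'I_m * 'I_n => `|A ij.1 ij.2|) (i, j)).
Qed.

Lemma normr_inner_le (R : realType) (n : nat) (u v : 'rV[R]_n) :
  `|inner u v| <= n%:R * (`|u| * `|v|).
Proof.
apply: (le_trans (ler_norm_sum _ _ _)).
apply: (@le_trans _ _ (\sum_(i < n) `|u| * `|v|)).
  by apply: ler_sum => i _; rewrite normrM ler_pM ?le_norm_coord.
by rewrite sumr_const card_ord mulr_natl.
Qed.

Lemma normr_mulmx_le (R : realType) (n : nat) (u : 'rV[R]_n) (A : 'M[R]_n) :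
  `|u *m A| <= n%:R * (`|u| * `|A|).
Proof.
have -> : `|u *m A| = mx_norm (u *m A) by [].
rewrite mx_normrE; apply: bigmax_le => [|[i j] _ /=].
  by rewrite !mulr_ge0.
rewrite mxE; apply: (le_trans (ler_norm_sum _ _ _)).
apply: (@le_trans _ _ (\sum_(i < n) `|u| * `|A|)).
  by apply: ler_sum => k _; rewrite normrM ler_pM ?le_norm_coord.
by rewrite sumr_const card_ord mulr_natl.
Qed.

(** * Convex combinations and compactness *)

Lemma convex_setE (R : numDomainType) (V : lmodType R) (A : set V) :
  convex_set A <-> forall (a b : V) (t : R), A a -> A b -> 0 <= t <= 1 ->
                   A (t *: a + (1 - t) *: b).
Proof.
split=> [cA a b t Aa Ab /andP[t0 t1]|cA a b t].
  by have := cA a b (Itv01 t0 t1); rewrite !inE; apply.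
by rewrite !inE => Aa Ab; apply: cA => //; apply/andP.
Qed.

(** The weights are not normalized: in the application they are step sizes, and
    their sum is the time elapsed over a block of Frank-Wolfe steps. *)
Lemma convex_weighted_mean (R : realType) (V : lmodType R) (A : set V)
    (w : nat -> R) (s : nat -> V) (l k : nat) :
  convex_set A -> (l < k)%N -> (forall i, (l <= i < k)%N -> 0 < w i) ->
  (forall i, (l <= i < k)%N -> A (s i)) ->
  0 < \sum_(l <= i < k) w i /\
  exists2 m, A m &
    \sum_(l <= i < k) w i *: s i = (\sum_(l <= i < k) w i) *: m.
Proof.
move=> /convex_setE cA; elim: k => // k IH.
rewrite ltnS leq_eqVlt => /predU1P[<-|lk] w0 sA.
  rewrite !big_nat1; split; first by apply: w0; rewrite leqnn ltnSn.
  by exists (s l) => //; apply: sA; rewrite leqnn ltnSn.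
have [||W0 [m Am mE]] := IH lk.
- by move=> i /andP[li ik]; apply: w0; rewrite li ltnW.
- by move=> i /andP[li ik]; apply: sA; rewrite li ltnW.
have wk : 0 < w k by apply: w0; rewrite ltnSn ltnW.
rewrite !big_nat_recr ?(ltnW lk)//= mE; move: W0.
set W := \sum_(l <= i < k) w i => W0.
have Wk : 0 < W + w k by rewrite addr_gt0.
split=> //.
have t01 : 0 <= W / (W + w k) <= 1.
  by rewrite divr_ge0 ?(ltW W0) ?(ltW Wk)//= ler_pdivrMr// mul1r lerDl ltW.
exists ((W / (W + w k)) *: m + (1 - W / (W + w k)) *: s k).
  by apply: cA => //; apply: sA; rewrite ltnSn ltnW.
rewrite scalerDr !scalerA; congr (_ *: _ + _ *: _); field; exact: lt0r_neq0.
Qed.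

Lemma compact_diameter (R : realType) (V : normedModType R) (C : set V) :
  compact C -> exists2 D : R, 0 < D & forall y z, C y -> C z -> `|y - z| <= D.
Proof.
move=> /compact_bounded[M [_ MC]]; have {}MC := MC (`|M| + 1).
have M1 : M < `|M| + 1 by rewrite ltr_pwDr// ler_norm.
exists (2 * (`|M| + 1)); first by rewrite mulr_gt0// ltr_wpDl.
move=> y z /(MC M1) /= yM /(MC M1) /= zM.
by apply: (le_trans (ler_normB _ _)); rewrite mulr_natl mulr2n lerD.
Qed.

(** Filter compactness read along a sequence: some point of C is approached
    at arbitrarily late times. *)
Lemma compact_seq_cluster (R : realType) (V : normedModType R) (C : set V)
    (u : nat -> V) :
  compact C -> (forall j, C (u j)) ->
  exists2 p, C p & forall (r : R) N, 0 < r ->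
    exists2 j, (N <= j)%N & `|u j - p| <= r.
Proof.
move=> cC uC; have uF : (u @ \oo) C by exists 0%N => // j _; exact: uC.
have [p [Cp pu]] := cC _ _ uF; exists p => // r N r0.
have uN : (u @ \oo) [set u j | j in [set j | (N <= j)%N]].
  by exists N => // j /= Nj; exists j.
have [_ [[j /= Nj <-]]] := pu _ _ uN (nbhsx_ballx p r r0).
by rewrite -ball_normE /= distrC => /ltW jr; exists j.
Qed.

(** * Derivatives relative to a set *)

Lemma within_nbhs_radius (R : realType) (V : normedModType R) (C P : set V)
    (p : V) :
  (\forall y \near within C (nbhs p), P y) ->
  exists2 r : R, 0 < r & forall y, C y -> `|y - p| <= r -> P y.
Proof.
move=> /nbhs_ballP[r /= r0 rP]; exists (r / 2); first exact: divr_gt0.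
move=> y Cy yp; apply: rP => //; rewrite -ball_normE /= distrC.
by rewrite (le_lt_trans yp)// ltr_pdivrMr// mulr_natr mulr2n ltrDl.
Qed.

(** C may have empty interior, so that A need not be determined by F. *)
Definition derivative_within (R : realType) (n : nat) (C : set 'rV[R]_n)
    (F : 'rV[R]_n -> 'rV[R]_n) (p : 'rV[R]_n) (A : 'M[R]_n) : Prop :=
  forall e : R, 0 < e -> \forall y \near within C (nbhs p),
    `|F y - F p - (y - p) *m A| <= e * `|y - p|.

Lemma derivative_within_cvg (R : realType) (n : nat) (C : set 'rV[R]_n)
    (F : 'rV[R]_n -> 'rV[R]_n) (p : 'rV[R]_n) (A : 'M[R]_n) :
  derivative_within C F p A -> F y @[y --> within C (nbhs p)] --> F p.
Proof.
move=> /(_ 1 ltr01)/within_nbhs_radius[r r0 rF].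
apply/cvgrPdist_le => e e0.
pose K := n%:R * `|A| + 1.
have K0 : 0 < K by rewrite ltr_wpDl// mulr_ge0.
apply/nbhs_ballP; exists (Num.min r (e / K)) => /=.
  by rewrite lt_min r0 divr_gt0.
move=> y; rewrite -ball_normE /= distrC lt_min => /andP[yr ye] Cy.
have /= yF := rF _ Cy (ltW yr).
have -> : F p - F y = - ((F y - F p - (y - p) *m A) + (y - p) *m A).
  by rewrite subrK opprB.
rewrite normrN; apply: (le_trans (ler_normD _ _)).
have yA := normr_mulmx_le (y - p) A.
apply: (@le_trans _ _ (K * `|y - p|)); first by rewrite /K; lra.
by rewrite mulrC -ler_pdivlMr// ltW.
Qed.

(** Monotonicity between p and p + t (s - p) reads
    0 <= t^2 <(s - p) A, s - p> + o(t^2); divide by t^2 and let t go to 0. *)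
Lemma monotone_derivative_ge0 (R : realType) (n : nat) (C : set 'rV[R]_n)
    (F : 'rV[R]_n -> 'rV[R]_n) (p s : 'rV[R]_n) (A : 'M[R]_n) :
  convex_set C -> monotone_on C F -> derivative_within C F p A ->
  C p -> C s -> 0 <= inner ((s - p) *m A) (s - p).
Proof.
move=> /convex_setE cC mF dF Cp Cs; set u := s - p.
apply/ler_addgt0Pr => e e0; set D := `|u|.
have D0 : 0 <= D by exact: normr_ge0.
pose K := n%:R * (D * D) + 1.
have K0 : 0 < K by rewrite ltr_wpDl// !mulr_ge0.
have [r r0 rF] := within_nbhs_radius (dF (e / K) (divr_gt0 e0 K0)).
pose t := Num.min 1 (r / (D + 1)).
have D1 : 0 < D + 1 by rewrite ltr_wpDl.
have t0 : 0 < t by rewrite lt_min ltr01 divr_gt0.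
have t1 : t <= 1 by rewrite ge_min lexx.
have tr : t * (D + 1) <= r by rewrite -ler_pdivlMr// ge_min lexx orbT.
pose y := t *: s + (1 - t) *: p.
have Cy : C y by apply: cC => //; rewrite ltW.
have yp : y - p = t *: u.
  by rewrite /y /u scalerBl scale1r scalerBr addrCA addrC addrK.
have ypE : `|y - p| = t * D by rewrite yp normrZ gtr0_norm.
have yr : `|y - p| <= r by rewrite ypE (le_trans _ tr)// ler_pM2l// lerDl.
have /= := rF _ Cy yr; rewrite ypE yp -scalemxAl.
set q := _ - t *: _ => qt.
have FE : F y - F p = q + t *: (u *m A) by rewrite /q subrK.
have := mF _ _ Cy Cp; rewrite yp FE innerZr innerDl innerZl pmulr_rge0//.
have qu := normr_inner_le q u.
have {}qu : inner q u <= t * e.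
  apply: (le_trans (ler_norm _)); apply: (le_trans qu).
  apply: (@le_trans _ _ (n%:R * (e / K * (t * D) * D))).
    by rewrite ler_wpM2l// ler_wpM2r.
  have -> : n%:R * (e / K * (t * D) * D) = t * (e * ((n%:R * (D * D)) / K)).
    by ring.
  rewrite ler_pM2l// -[leRHS]mulr1 ler_pM2l// ler_pdivrMr// mul1r /K.
  by rewrite lerDl.
move=> h; have : 0 <= t * (inner (u *m A) u + e) by lra.
by rewrite pmulr_rge0.
Qed.

(** * The gap function *)

Lemma inner_le_fw_gap (R : realType) (n : nat) (C : set 'rV[R]_n)
    (F : 'rV[R]_n -> 'rV[R]_n) (y t : 'rV[R]_n) :
  compact C -> C t -> inner (F y) (y - t) <= fw_gap C F y.
Proof.
by move=> cC Ct; have [_] := fw_gap_max F y (ex_intro _ t Ct) cC; apply.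
Qed.

Lemma fw_gap_argmin (R : realType) (n : nat) (C : set 'rV[R]_n)
    (F : 'rV[R]_n -> 'rV[R]_n) (y t : 'rV[R]_n) :
  compact C -> argmin_on C (inner (F y)) t ->
  fw_gap C F y = inner (F y) (y - t).
Proof.
move=> cC [Ct tmin]; apply/eqP; rewrite eq_le inner_le_fw_gap// andbT.
have [[z Cz ->] _] := fw_gap_max F y (ex_intro _ t Ct) cC.
by rewrite !innerBr lerB// tmin.
Qed.

(** A point s attaining the gap at y is a competitor in the gap at p, so the
    gap at y exceeds the one at p by at most <F y - F p, y - s> + <F p, y - p>.
    *)
Lemma fw_gap_usc (R : realType) (n : nat) (C : set 'rV[R]_n)
    (F : 'rV[R]_n -> 'rV[R]_n) (p : 'rV[R]_n) :
  compact C -> F y @[y --> within C (nbhs p)] --> F p -> forall e : R, 0 < e ->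
  exists2 r : R, 0 < r &
    forall y, C y -> `|y - p| <= r -> fw_gap C F y <= fw_gap C F p + e.
Proof.
move=> cC Fp e e0; have [D D0 CD] := compact_diameter cC.
pose N : R := n%:R.
have N0 : 0 <= N by [].
pose K := N * D + N * `|F p| + 1.
have K0 : 0 < K.
  by rewrite ltr_wpDl// addr_ge0// mulr_ge0// ltW.
have d0 : 0 < e / K by rewrite divr_gt0.
have eK : e = N * (e / K * D) + N * (`|F p| * (e / K)) + e / K.
  by transitivity (K * (e / K)); [field; exact: lt0r_neq0 | rewrite /K; ring].
move/cvgrPdist_le/(_ _ d0)/within_nbhs_radius : Fp => [r r0 rF].
exists (Num.min r (e / K)); first by rewrite lt_min r0.
move=> y Cy; rewrite le_min => /andP[/(rF _ Cy)/= Fy yp].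
have [[s Cs ->] _] := fw_gap_max F y (ex_intro _ y Cy) cC.
have := inner_le_fw_gap F p cC Cs.
have : inner (F y - F p) (y - s) <= N * (e / K * D).
  apply: (le_trans (ler_norm _)); apply: (le_trans (normr_inner_le _ _)).
  by rewrite ler_wpM2l// ler_pM// ?CD// distrC.
have : inner (F p) (y - p) <= N * (`|F p| * (e / K)).
  apply: (le_trans (ler_norm _)); apply: (le_trans (normr_inner_le _ _)).
  by rewrite ler_wpM2l// ler_wpM2l.
move: (e / K) d0 eK => d d0 ->.
by rewrite innerBl !innerBr; lra.
Qed.

(** * The gap cannot be positive at the end of a backward chord *)

(** The point q plays the role of the position a short time T before reaching
    p, with velocity s - p up to an error e. At q the gap is hardly larger than
    at p, which is what maximality of the gap at p among limit points provides.
    *)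
Definition backward_direction (R : realType) (n : nat) (C : set 'rV[R]_n)
    (F : 'rV[R]_n -> 'rV[R]_n) (p s : 'rV[R]_n) (e : R) : Prop :=
  exists T q, [/\ 0 < T <= e, C q, fw_gap C F q <= fw_gap C F p + e * T &
                  `|p - q - T *: (s - p)| <= e * T].

(** Since s attains the gap V(p) and competes in V(q),
      V(p) - V(q) <= <F p, p - q> + <F p - F q, p - s> - <F p - F q, p - q>.
    The last term is at most 0 by monotonicity. With p - q = T (s - p) + o(T),
    the first is - T V(p) + o(T), and the second is
    - T <(s - p) A, s - p> + o(T), at most o(T) by monotonicity again. As
    V(p) - V(q) >= - o(T), dividing by T gives V(p) <= 0. It is essential that
    the direction s - p of the chord and the competitor s are the same. *)
Lemma backward_gap_le0 (R : realType) (n : nat) (C : set 'rV[R]_n)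
    (F : 'rV[R]_n -> 'rV[R]_n) (p s : 'rV[R]_n) (A : 'M[R]_n) :
  compact C -> convex_set C -> monotone_on C F -> derivative_within C F p A ->
  C p -> argmin_on C (inner (F p)) s ->
  (forall e : R, 0 < e -> backward_direction C F p s e) ->
  fw_gap C F p <= 0.
Proof.
move=> cC vC mF dF Cp smin back; have Cs : C s by case: smin.
have dd := monotone_derivative_ge0 vC mF dF Cp Cs.
pose D := `|s - p|; pose N : R := n%:R.
have D0 : 0 <= D by exact: normr_ge0.
have N0 : 0 <= N by [].
(* Its three summands account for the errors in V(q), in <F p, p - q> and in
   <F p - F q, p - s>, each divided by e T. *)
pose K := 1 + N * `|F p| + N * ((N * `|A| + D + 1) * D).
have K0 : 0 < K.
  by rewrite /K -addrA ltr_wpDr// addr_ge0// !mulr_ge0// !addr_ge0// mulr_ge0.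
suff gapK e : 0 < e -> e <= 1 -> fw_gap C F p <= e * K.
  apply/ler_addgt0Pr => e e0; rewrite add0r.
  have d0 : 0 < Num.min 1 (e / K) by rewrite lt_min ltr01 divr_gt0.
  apply: (le_trans (gapK _ d0 _)); first by rewrite ge_min lexx.
  by rewrite -ler_pdivlMr// ge_min lexx orbT.
move=> e0 e1; have [r r0 rF] := within_nbhs_radius (dF e e0).
(* A chord with T <= d stays within the radius r where F is e-linear at p. *)
pose d := Num.min e (r / (D + 1)).
have D1 : 0 < D + 1 by rewrite ltr_wpDl.
have d0 : 0 < d by rewrite lt_min e0 divr_gt0.
have de : d <= e by rewrite ge_min lexx.
have dr : d * (D + 1) <= r by rewrite -ler_pdivlMr// ge_min lexx orbT.
have [T [q [/andP[T0 Td] Cq gapq]]] := back d d0.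
set z := p - q - _ => zd.
have pqE : p - q = T *: (s - p) + z by rewrite [RHS]addrC subrK.
have ze : `|z| <= e * T by apply: (le_trans zd); rewrite ler_pM2r.
have pq : `|q - p| <= T * (D + 1).
  rewrite distrC pqE (le_trans (ler_normD _ _))// normrZ gtr0_norm//.
  rewrite mulrDr lerD// mulr1 (le_trans ze)// -[leRHS]mul1r ler_pM2r//.
have qr : `|q - p| <= r.
  by rewrite (le_trans pq)// (le_trans _ dr)// ler_pM2r.
have /= := rF _ Cq qr; set w := F q - F p - _ => wE.
have {wE} we : `|w| <= e * (T * (D + 1)) by rewrite (le_trans wE)// ler_pM2l.
have FE : F p - F q = T *: ((s - p) *m A) + (z *m A - w).
  rewrite scalemxAl addrA -mulmxDl -pqE /w opprB addrA -mulmxDl.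
  by rewrite addrA subrK subrr mul0mx add0r opprB.
have gapp := fw_gap_argmin cC smin.
have gapq' := inner_le_fw_gap F q cC Cs.
have mono := mF _ _ Cp Cq.
have h1 : inner (F p) (p - q) <= - T * fw_gap C F p + e * T * (N * `|F p|).
  rewrite pqE innerDr innerZr gapp -(opprB s p) innerNr mulrNN lerD2l.
  apply: (le_trans (ler_norm _)); apply: (le_trans (normr_inner_le _ _)).
  have : N * `|F p| * `|z| <= N * `|F p| * (e * T).
    by rewrite ler_wpM2l// mulr_ge0.
  by rewrite -/N; lra.
have h2 : inner (F p - F q) (p - s) <=
    e * T * (N * ((N * `|A| + D + 1) * D)).
  rewrite FE innerDl innerZl -(opprB s p) innerNr mulrN.
  have sp : inner (z *m A - w) (- (s - p)) <= N * (`|z *m A - w| * D).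
    apply: (le_trans (ler_norm _)); apply: (le_trans (normr_inner_le _ _)).
    by rewrite normrN.
  have zAw : `|z *m A - w| <= e * T * (N * `|A| + D + 1).
    have zA : `|z *m A| <= N * (e * T * `|A|).
      apply: (le_trans (normr_mulmx_le _ _)).
      by rewrite ler_wpM2l// ler_wpM2r.
    by rewrite (le_trans (ler_normB _ _))//; lra.
  have : N * (`|z *m A - w| * D) <= N * (e * T * (N * `|A| + D + 1) * D).
    by rewrite ler_wpM2l// ler_wpM2r.
  have : 0 <= T * inner ((s - p) *m A) (s - p) by rewrite mulr_ge0// ltW.
  by lra.
have : T * fw_gap C F p <= T * (e * K).
  have gapE : fw_gap C F p - inner (F q) (q - s) =
      inner (F p) (p - q) + inner (F p - F q) (p - s) -
      inner (F p - F q) (p - q).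
    rewrite gapp !(innerBl, innerBr); ring.
  have : fw_gap C F p - inner (F q) (q - s) >= - (e * T).
    have : d * T <= e * T by rewrite ler_pM2r.
    lra.
  rewrite /K; lra.
by rewrite ler_pM2l.
Qed.

(** Chords in directions m - p with m an e-minimizer, one for each e, yield a
    single exact minimizer s that serves for all e: take a cluster point of the
    m as e tends to 0. *)
Lemma backward_argmin (R : realType) (n : nat) (C : set 'rV[R]_n)
    (F : 'rV[R]_n -> 'rV[R]_n) (p : 'rV[R]_n) :
  compact C ->
  (forall e : R, 0 < e -> exists m, [/\ C m,
     forall t, C t -> inner (F p) m <= inner (F p) t + e &
     backward_direction C F p m e]) ->
  exists2 s, argmin_on C (inner (F p)) s &
    forall e : R, 0 < e -> backward_direction C F p s e.
Proof.
move=> cC chords.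
have /choice[u uP] j := chords j.+1%:R^-1 (ltac:(by rewrite invr_gt0)).
have [|s Cs us] := compact_seq_cluster (u := u) cC.
  by move=> j; case: (uP j).
have close (e : R) : 0 < e -> exists j, j.+1%:R^-1 <= e /\ `|u j - s| <= e.
  move=> e0; have [N _ Ne] := near_infty_natSinv_lt (PosNum e0).
  have [j Nj uj] := us e N e0; exists j; split=> //.
  by rewrite ltW//; exact: (Ne j Nj).
exists s.
  split=> // t Ct; apply/ler_addgt0Pr => e e0.
  pose K : R := n%:R * `|F p| + 1.
  have K0 : 0 < K by rewrite ltr_wpDl// mulr_ge0.
  have [|j [je uj]] := close (e / (K + 1)).
    by rewrite divr_gt0// addr_gt0.
  have [_ /(_ t Ct) umin _] := uP j.
  have : inner (F p) (s - u j) <= K * (e / (K + 1)).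
    apply: (le_trans (ler_norm _)); apply: (le_trans (normr_inner_le _ _)).
    rewrite mulrA ler_pM ?mulr_ge0//; first by rewrite /K lerDl.
    by rewrite distrC.
  have : e = K * (e / (K + 1)) + e / (K + 1).
    by field; rewrite lt0r_neq0// addr_gt0.
  rewrite innerBr; move: (e / (K + 1)) je => f.
  by move: (j.+1%:R^-1) umin => d; lra.
move=> e e0; have [|j [je uj]] := close (e / 2); first by rewrite divr_gt0.
have [_ _ [T [q [/andP[T0 Te] Cq gapq pq]]]] := uP j.
move: je Te gapq pq; move: (j.+1%:R^-1) => d de Td gapq pq.
have de' : d <= e by lra.
exists T, q; split=> //; first by rewrite T0 (le_trans Td).
  by rewrite (le_trans gapq)// lerD2l ler_pM2r.
have -> : p - q - T *: (s - p) = (p - q - T *: (u j - p)) + T *: (u j - s).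
  have -> : u j - s = (u j - p) - (s - p) by rewrite opprB addrA subrK.
  by rewrite [T *: (u j - p - _)]scalerBr addrA subrK.
rewrite (le_trans (ler_normD _ _))// normrZ gtr0_norm//.
have : T * `|u j - s| <= T * (e / 2) by rewrite ler_pM2l.
have : d * T <= e / 2 * T by rewrite ler_pM2r.
by lra.
Qed.

(** * Chords along the Frank-Wolfe sequence *)

(** Choose the latest l for which the sum is still at least tau: it exceeds tau
    by at most its first term, and late terms are at most tau. *)
Lemma step_window (R : realType) (w : nat -> R) (tau : R) (N : nat) :
  (forall i, 0 < w i) -> w i @[i --> \oo] --> 0 ->
  \sum_(0 <= i < k) w i @[k --> \oo] --> +oo -> 0 < tau ->
  exists K, forall k, (K <= k)%N ->
    exists2 l, (N <= l < k)%N & tau <= \sum_(l <= i < k) w i <= 2 * tau.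
Proof.
move=> w0 wc sw tau0.
have /cvgr0Pnorm_le/(_ tau tau0)[N1 _ N1w] := wc.
pose M := maxn N N1.
move/cvgryPge/(_ (tau + \sum_(0 <= i < M) w i)): sw => [K _ KP].
exists (maxn K M) => k; rewrite geq_max => /andP[Kk Mk].
have Mtau : tau <= \sum_(M <= i < k) w i.
  by have := KP k Kk; rewrite /= (big_cat_nat _ Mk)//= addrC lerD2r.
pose P l := [&& (M <= l)%N, (l <= k)%N & tau <= \sum_(l <= i < k) w i].
have exP : exists l, P l by exists M; rewrite /P leqnn Mk.
have bP l : P l -> (l <= k)%N by case/and3P.
case: (ex_maxnP exP bP) => l /and3P[Ml lk taul] lmax.
have {}lk : (l < k)%N.
  rewrite ltn_neqAle lk andbT; apply/eqP => lkE.
  by move: taul; rewrite lkE big_geq// leNgt tau0.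
exists l; first by rewrite lk (leq_trans (leq_maxl _ _) Ml).
rewrite taul /= big_ltn//.
have wl : w l <= tau.
  rewrite -[w l]gtr0_norm//; apply: N1w => /=.
  exact: leq_trans (leq_maxr _ _) Ml.
suff : \sum_(l.+1 <= i < k) w i < tau by lra.
rewrite ltNge; apply/negP => tauS.
have := lmax l.+1; rewrite /P tauS lk (leqW Ml) ltnn.
by move=> /(_ isT).
Qed.

Lemma frank_wolfe_in (R : realType) (n : nat) (C : set 'rV[R]_n)
    (F : 'rV[R]_n -> 'rV[R]_n) (gamma : nat -> R) (x s : nat -> 'rV[R]_n) :
  convex_set C -> (forall k, (1 <= k)%N -> 0 < gamma k <= 1) ->
  frank_wolfe C F gamma x s -> forall k, C (x k).
Proof.
move=> /convex_setE cC g01 [Cx0 step]; elim=> // k Cxk.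
have [[Csk _] ->] := step k; have /andP[g0 g1] := g01 k.+1 isT.
have -> : x k + gamma k.+1 *: (s k - x k) =
    gamma k.+1 *: s k + (1 - gamma k.+1) *: x k.
  by rewrite scalerBr scalerBl scale1r addrCA.
by apply: cC => //; rewrite ltW.
Qed.

(** Look back from an index k with x_k very close to p to the index l at which
    the elapsed time T, the sum of the intermediate step sizes, is about tau.
    Then x_k - x_l = T m - sum of gamma_(i+1) x_i, where m is the mean of the
    s_i weighted by the step sizes, and all x_i in the window are within O(tau)
    of p. Hence p - x_l = T (m - p) + O(tau^2). Each s_i minimizes <F x_i, .>
    and F is continuous at p, so s_i is an e-minimizer of <F p, .>; the
    e-minimizers form a convex set, which therefore contains m. *)
Lemma frank_wolfe_backward (R : realType) (n : nat) (C : set 'rV[R]_n)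
    (F : 'rV[R]_n -> 'rV[R]_n) (gamma : nat -> R) (x s : nat -> 'rV[R]_n)
    (p : 'rV[R]_n) :
  compact C -> convex_set C ->
  (forall k, (1 <= k)%N -> 0 < gamma k <= 1) ->
  gamma k @[k --> \oo] --> 0 ->
  \sum_(1 <= k < N.+1) gamma k @[N --> \oo] --> +oo ->
  frank_wolfe C F gamma x s ->
  C p -> F y @[y --> within C (nbhs p)] --> F p ->
  (forall (r : R) N, 0 < r -> exists2 k, (N <= k)%N & `|x k - p| <= r) ->
  (forall r : R, 0 < r ->
     exists N, forall k, (N <= k)%N -> fw_gap C F (x k) <= fw_gap C F p + r) ->
  forall e : R, 0 < e -> exists m, [/\ C m,
     forall t, C t -> inner (F p) m <= inner (F p) t + e &
     backward_direction C F p m e].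
Proof.
move=> cC vC g01 gc0 gsum fw Cp Fp xp gapx e e0.
have xC := frank_wolfe_in vC g01 fw.
have [_ step] := fw.
have sC k : C (s k) by have [[]] := step k.
have [D D0 CD] := compact_diameter cC.
pose w i := gamma i.+1.
have w0 i : 0 < w i by have /andP[] := g01 i.+1 isT.
have wc : w i @[i --> \oo] --> 0 by rewrite cvg_shiftS.
have wsum : \sum_(0 <= i < k) w i @[k --> \oo] --> +oo.
  apply: cvg_trans gsum; apply: near_eq_cvg; apply: nearW => k.
  by rewrite /w big_add1.
pose N0 : R := n%:R.
have K0 : 0 < N0 * D + 1 by rewrite ltr_wpDl// mulr_ge0// ltW.
have /cvgrPdist_le/(_ _ (divr_gt0 e0 K0))/within_nbhs_radius[r r0 rF] := Fp.
have D1 : 0 < 2 + 2 * D by lra.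
(* The window lasts T <= 2 tau, so the iterates in it are within
   2 tau D + tau^2 <= tau (1 + 2 D) <= r of p. *)
pose tau := Num.min 1 (Num.min e r / (2 + 2 * D)).
have er0 : 0 < Num.min e r by rewrite lt_min e0 r0.
have tau0 : 0 < tau by rewrite lt_min ltr01 divr_gt0.
have tau1 : tau <= 1 by rewrite ge_min lexx.
have : tau * (2 + 2 * D) <= Num.min e r.
  by rewrite -ler_pdivlMr// ge_min lexx orbT.
rewrite le_min => /andP[taue taur].
have tauD : 0 < tau * D by rewrite mulr_gt0.
have tautau : tau * tau <= tau by rewrite -[leRHS]mulr1 ler_pM2l.
have [N NP] := gapx (e * tau) (mulr_gt0 e0 tau0).
have [K KP] := step_window N w0 wc wsum tau0.
(* Second order closeness to p makes p - x_k negligible against e T. *)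
have [k Kk xkp] := xp (tau * tau) K (mulr_gt0 tau0 tau0).
have [l /andP[Nl lk] /andP[tauT T2]] := KP k Kk.
set T := \sum_(l <= i < k) w i in tauT T2.
have T0 : 0 < T by exact: lt_le_trans tauT.
have xdiff i : (i <= k)%N -> x k - x i = \sum_(i <= j < k) w j *: (s j - x j).
  move=> ik; rewrite -telescope_sumr//; apply: eq_bigr => j _.
  by have [_ ->] := step j; rewrite addrC addKr.
have xkD i : (l <= i <= k)%N -> `|x k - x i| <= T * D.
  move=> /andP[li ik]; rewrite xdiff// (le_trans (ler_norm_sum _ _ _))//.
  apply: (@le_trans _ _ (\sum_(i <= j < k) w j * D)).
    by apply: ler_sum => j _; rewrite normrZ gtr0_norm// ler_pM2l// CD.
  rewrite -mulr_suml ler_pM2r// /T (big_cat_nat li ik)//= lerDr.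
  by apply: sumr_ge0 => j _; rewrite ltW.
have xpD i : (l <= i <= k)%N -> `|x i - p| <= tau * (1 + 2 * D).
  move=> lik; rewrite -(subrKA (x k)) (le_trans (ler_normD _ _))// distrC.
  have : T * D <= 2 * tau * D by rewrite ler_pM2r.
  by have := xkD i lik; lra.
pose A := [set m | C m /\
  forall t, C t -> inner (F p) m <= inner (F p) t + e].
have vA : convex_set A.
  move/convex_setE : vC => vC; apply/convex_setE => a b t [Ca aP] [Cb bP] t01.
  split=> [|y Cy]; first exact: vC.
  have /andP[t0 t1] := t01; rewrite innerDr !innerZr.
  have : t * inner (F p) a <= t * (inner (F p) y + e).
    by rewrite ler_wpM2l// aP.
  have : (1 - t) * inner (F p) b <= (1 - t) * (inner (F p) y + e).
    by rewrite ler_wpM2l ?subr_ge0// bP.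
  by lra.
have sA i : (l <= i < k)%N -> A (s i).
  move=> /andP[li ik]; split=> // t Ct.
  have lik : (l <= i <= k)%N by rewrite li ltnW.
  have Fi : `|F p - F (x i)| <= e / (N0 * D + 1).
    by apply: rF => //; apply: (le_trans (xpD i lik)); lra.
  have [[_ /(_ t Ct) simin] _] := step i.
  have : inner (F p - F (x i)) (s i - t) <= e.
    apply: (le_trans (ler_norm _)); apply: (le_trans (normr_inner_le _ _)).
    apply: (@le_trans _ _ (N0 * (e / (N0 * D + 1) * D))).
      by rewrite ler_wpM2l// ler_pM// CD.
    have -> : N0 * (e / (N0 * D + 1) * D) = e * (N0 * D / (N0 * D + 1)).
      by ring.
    by rewrite -[leRHS]mulr1 ler_pM2l// ler_pdivrMr// mul1r lerDl.
  by rewrite innerBl !innerBr; lra.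
have [_ [m [Cm mmin] mE]] := convex_weighted_mean vA lk (fun i _ => w0 i) sA.
exists m; split=> //; exists T, (x l); split=> //.
- by rewrite T0; lra.
- by rewrite (le_trans (NP l Nl))// lerD2l ler_pM2l.
have -> : p - x l - T *: (m - p) =
    (p - x k) - \sum_(l <= i < k) w i *: (x i - p).
  have -> : \sum_(l <= i < k) w i *: (x i - p) = T *: (m - p) - (x k - x l).
    rewrite xdiff ?(ltnW lk)// scalerBr -mE /T scaler_suml -!sumrB.
    apply: eq_bigr => i _.
    by rewrite -!scalerBr opprB [in RHS]addrC addrA subrK.
  by rewrite opprB addrA subrKA.
rewrite (le_trans (ler_normB _ _))// distrC.
have S : `|\sum_(l <= i < k) w i *: (x i - p)| <= T * (tau * (1 + 2 * D)).
  rewrite (le_trans (ler_norm_sum _ _ _))// /T mulr_suml.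
  rewrite big_nat_cond [leRHS]big_nat_cond; apply: ler_sum => i.
  rewrite andbT => /andP[li ik]; rewrite normrZ gtr0_norm// ler_pM2l//.
  by apply: xpD; rewrite li ltnW.
have : tau * tau <= T * tau by rewrite ler_pM2r.
have : T * (tau * (2 + 2 * D)) <= T * e by rewrite ler_pM2l.
by lra.
Qed.

(** * Limit superior and conclusion *)

(** The real number v is the limit superior of u. The first half bounds the gap
    at the start of a chord, the second supplies the point where chords end. *)
Lemma bounded_limsup (R : realType) (u : nat -> R) (a b : R) :
  (forall k, a <= u k <= b) -> exists v,
  (forall e : R, 0 < e -> exists N, forall k, (N <= k)%N -> u k <= v + e) /\
  (forall (e : R) N, 0 < e -> exists2 k, (N <= k)%N & v - e <= u k).
Proof.
move=> uab.
pose E := [set v | exists N, forall k, (N <= k)%N -> u k <= v].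
have E0 : has_inf E.
  split; first by exists b, 0%N => k _; have /andP[] := uab k.
  by exists a => v [N /(_ N (leqnn N))]; apply: le_trans; case/andP: (uab N).
exists (inf E); split=> e.
  move=> e0; have [v [N Nv] ve] := inf_adherent e0 E0.
  by exists N => k Nk; rewrite (le_trans (Nv k Nk))// ltW.
move=> N e0; apply: contrapT => noex.
have : E (inf E - e).
  exists N => k Nk; rewrite leNgt; apply/negP => uk; apply: noex.
  by exists k => //; exact: ltW.
by move=> /(ge_inf E0.2); rewrite leNgt gtrBl e0.
Qed.

Theorem corollary8 (R : realType) (n : nat) (C : set 'rV[R]_n)
    (F : 'rV[R]_n -> 'rV[R]_n) (gamma : nat -> R) (x s : nat -> 'rV[R]_n)
    (C_neq0 : C !=set0) (C_compact : compact C) (C_convex : convex_set C)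
    (F_monotone : monotone_on C F) (F_C1 : C1_on C F)
    (gamma01 : forall k, (1 <= k)%N -> 0 < gamma k <= 1)
    (gamma_cvg0 : gamma k @[k --> \oo] --> 0)
    (gamma_sum : \sum_(1 <= k < N.+1) gamma k @[N --> \oo] --> +oo)
    (x_fw : frank_wolfe C F gamma x s) :
  fw_gap C F (x k) @[k --> \oo] --> 0.
Proof.
have [dF [_ dFP]] := F_C1.
have xC := frank_wolfe_in C_convex gamma01 x_fw.
have Fcvg p : C p -> F y @[y --> within C (nbhs p)] --> F p.
  by move=> Cp; exact: derivative_within_cvg (dFP p Cp).
have gap_ge0 k : 0 <= fw_gap C F (x k).
  have := inner_le_fw_gap F (x k) C_compact (xC k).
  by rewrite innerBr subrr.
have [B gapB] : exists B, forall k, fw_gap C F (x k) <= B.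
  have [D D0 CD] := compact_diameter C_compact.
  have : compact (F @` C).
    apply: continuous_compact => //; exact/subspace_continuousP.
  move=> /compact_diameter[M M0 FM].
  exists (n%:R * ((`|F (x 0)| + M) * D)) => k.
  have [[t Ct ->] _] := fw_gap_max F (x k) C_neq0 C_compact.
  apply: (le_trans (ler_norm _)); apply: (le_trans (normr_inner_le _ _)).
  rewrite ler_wpM2l// ler_pM// ?CD//.
  rewrite -(subrK (F (x 0)) (F (x k))) addrC (le_trans (ler_normD _ _))//.
  by rewrite lerD2l FM//; [exists (x k)|exists (x 0)].
have [|v [v_ub v_freq]] :=
  @bounded_limsup R (fun k => fw_gap C F (x k)) 0 B.
  by move=> k; rewrite gap_ge0 gapB.
suff v_le0 : v <= 0.
  apply/cvgr0Pnorm_le => e e0; have [N Nv] := v_ub e e0.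
  exists N => // k /= Nk; rewrite ger0_norm ?gap_ge0//.
  by rewrite (le_trans (Nv k Nk))// gerDr.
(* p is a cluster point of the subsequence along which the gap approaches its
   limit superior, so that the gap at p is at least v. *)
have /choice[f fP] (j : nat) : exists k, (j <= k)%N /\
    v - j.+1%:R^-1 <= fw_gap C F (x k).
  have [|k jk vk] := v_freq j.+1%:R^-1 j; first by rewrite invr_gt0.
  by exists k.
have [|p Cp pf] := @compact_seq_cluster R _ C (x \o f) C_compact.
  by move=> j; exact: xC.
have gapp : v <= fw_gap C F p.
  apply/ler_addgt0Pr => e e0; have e20 : 0 < e / 2 by rewrite divr_gt0.
  have [r r0 rP] := fw_gap_usc C_compact (Fcvg p Cp) e20.
  have [N _ Ne] := near_infty_natSinv_lt (PosNum e20).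
  have [j Nj /(rP _ (xC _))/= pj] := pf r N r0.
  have [_ vj] := fP j; have /= je := Ne j Nj.
  move: (j.+1%:R^-1) vj je => d vj je.
  have ee : e = e / 2 + e / 2 by field.
  by rewrite ee; move: (e / 2) pj je => h; lra.
apply: (le_trans gapp).
have [|t tmin back] := @backward_argmin R n C F p C_compact.
  apply: (frank_wolfe_backward C_compact C_convex gamma01 gamma_cvg0 gamma_sum
    x_fw Cp (Fcvg p Cp)).
  - move=> r N r0; have [j Nj jr] := pf r N r0.
    by exists (f j) => //; apply: leq_trans Nj _; case: (fP j).
  - move=> r r0; have [N Nv] := v_ub r r0; exists N => k Nk.
    by rewrite (le_trans (Nv k Nk))// lerD2r.
exact: backward_gap_le0 (dFP p Cp) Cp tmin back.
Qed.
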